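(* Let $n\ge 1$ and $d\ge 1$ be integers and let $A$ and $B$ be measurable sets of positive measure in $\mathbb{T}^d$. Let $b_1,\dots,b_n$ be chosen independently and uniformly at random from $B$. If $|A|+|B|\le 1$, then $$\mathbb{E}\Big(\Big|\bigcup_{i=1}^n(A+b_i)\Big|\Big)\ \ge\ |A|+\tfrac{n-1}{n+1}|B|-\tfrac{n-1}{n+1}|B|\Big(1-\tfrac{|A|}{|B|}\Big)^{n+1}\mathbf{1}_{|A|<|B|},$$ and if $|A|+|B|>1$, then $$\mathbb{E}\Big(\Big|\bigcup_{i=1}^n(A+b_i)\Big|\Big)\ \ge\ 1-\Big(\tfrac{1-|A|}{|B|}\Big)^n\Big(|B|-\tfrac{n-1}{n+1}(1-|A|)\Big)-\tfrac{n-1}{n+1}|B|\Big(1-\tfrac{|A|}{|B|}\Big)^{n+1}\mathbf{1}_{|A|<|B|}.$$ Here $\mathbf{1}_{|A|<|B|}$ is $1$ if $|A|<|B|$ and $0$ otherwise.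
   Context: $\mathbb{T}=\mathbb{R}/\mathbb{Z}$ is the circle, and $|\cdot|$ denotes Lebesgue (Haar probability) measure on $\mathbb{T}^d$. $A+b=\{a+b: a\in A\}$. *)

(* Defs.v *)
From HB Require Import structures.
From mathcomp Require Import all_boot all_order all_algebra.
From mathcomp Require Import ring_quotient.
From mathcomp Require Import all_classical all_reals all_analysis.
From mathcomp Require Import measurable_realfun.

Set Implicit Arguments.
Unset Strict Implicit.
Unset Printing Implicit Defensive.
Import Order.TTheory GRing.Theory Num.Theory.
Import numFieldNormedType.Exports.

Local Open Scope classical_set_scope.
Local Open Scope ring_scope.
Local Open Scope quotient_scope.

(* The predicate Num.int is a qualifier; the quotient construction needs a
   plain predicate carrying the zmodClosed structure. *)
Definition integer (R : realType) : {pred R} := fun x => x \is a Num.int.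

Section integer_closed.
Variable R : realType.

Fact integer_zmod_closed : zmod_closed (@integer R).
Proof.
split; first exact: rpred0.
by move=> x y xZ yZ; exact: (rpredB xZ yZ).
Qed.

HB.instance Definition _ :=
  GRing.isZmodClosed.Build R (@integer R) integer_zmod_closed.

End integer_closed.

Definition circle (R : realType) : Type := @Quotient.quot R (@integer R).

Section circle.
Variable R : realType.
Local Notation T := (circle R).

HB.instance Definition _ := GRing.Zmodule.on T.
HB.instance Definition _ := Quotient.on T.
HB.instance Definition _ := isPointed.Build T 0.

Definition circle_pi : measurableTypeR R -> T := \pi_T.

(* Quotient sigma-algebra of the Borel sigma-algebra of R (= Borel sets of
   R/Z). *)
Definition circle_measurable : set_system T :=
  [set E | measurable (circle_pi @^-1` E)].

Fact circle_measurable0 : circle_measurable set0.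
Proof. by rewrite /circle_measurable /= preimage_set0. Qed.

Fact circle_measurableC (E : set T) :
  circle_measurable E -> circle_measurable (~` E).
Proof. by move=> mE; rewrite /circle_measurable /= preimage_setC; exact: measurableC. Qed.

Fact circle_measurable_bigcup (F : (set T)^nat) :
  (forall k, circle_measurable (F k)) -> circle_measurable (\bigcup_k F k).
Proof.
by move=> mF; rewrite /circle_measurable /= preimage_bigcup; apply: bigcupT_measurable.
Qed.

HB.instance Definition _ := isMeasurable.Build default_measure_display T
  circle_measurable0 circle_measurableC circle_measurable_bigcup.

Fact measurable_circle_pi : measurable_fun setT circle_pi.
Proof. by move=> _ E mE; rewrite setTI. Qed.

HB.instance Definition _ := isMeasurableFun.Build _ _ _ _ circle_pi
  measurable_circle_pi.

(* The Haar probability measure of R/Z: the law of x mod 1 for x uniform on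
   [0, 1]. *)
Definition circle_haar : probability T R :=
  distribution (uniform_prob (@ltr01 R)) circle_pi.

End circle.

Definition torus (R : realType) (d : nat) : Type := d.-tuple (circle R).

Section torus.
Variable R : realType.

HB.instance Definition _ (d : nat) := Choice.on (torus R d).
HB.instance Definition _ (d : nat) := Measurable.on (torus R d).

Section zmodule.
Variable d : nat.
Local Notation T := (torus R d).

Definition torus_zero : T := [tuple 0 | i < d].
Definition torus_opp (x : T) : T := [tuple - tnth x i | i < d].
Definition torus_add (x y : T) : T := [tuple tnth x i + tnth y i | i < d].

Fact torus_addA : associative torus_add.
Proof. by move=> x y z; apply: eq_from_tnth => i; rewrite !tnth_mktuple addrA. Qed.

Fact torus_addC : commutative torus_add.
Proof. by move=> x y; apply: eq_from_tnth => i; rewrite !tnth_mktuple addrC. Qed.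

Fact torus_add0 : left_id torus_zero torus_add.
Proof. by move=> x; apply: eq_from_tnth => i; rewrite !tnth_mktuple add0r. Qed.

Fact torus_addN : left_inverse torus_zero torus_opp torus_add.
Proof. by move=> x; apply: eq_from_tnth => i; rewrite !tnth_mktuple addNr. Qed.

HB.instance Definition _ :=
  GRing.isZmodule.Build T torus_addA torus_addC torus_add0 torus_addN.

Definition torus_cons (x : circle R * T) : torus R d.+1 :=
  [the d.+1.-tuple (circle R) of x.1 :: x.2].

Fact measurable_torus_cons : measurable_fun [set: circle R * T] torus_cons.
Proof. exact: measurable_cons. Qed.

HB.instance Definition _ := isMeasurableFun.Build _ _ _ _ torus_cons
  measurable_torus_cons.

End zmodule.

(* The product measure, by recursion on the dimension; the library has only
   binary products. *)
Fixpoint torus_haar (d : nat) : probability (torus R d) R :=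
  match d with
  | 0 => \d_([tuple] : torus R 0)
  | d'.+1 => distribution (circle_haar R \x torus_haar d')%E (@torus_cons d')
  end.

End torus.

Section lebesgue.
Variables (R : realType) (d : nat).
Implicit Types A : set (torus R d).

(* The sigma-algebra carried by torus R d consists of the Borel sets;
   Lebesgue measurability is membership in its completion for the Haar
   measure. *)
Definition lebesgue_measurable A : Prop :=
  completed_algebra_gen (torus_haar R d) A.

(* The Haar measure extended to its completion. The outer measure is defined on
   all sets; on a Lebesgue measurable set it is the measure of any Borel set
   differing from it by a null set. It is at most 1, so fine loses nothing. *)
Definition vol A : R := fine ((torus_haar R d)^*%mu A).

Definition translate A (b : torus R d) : set (torus R d) :=
  [set a + b | a in A].

End lebesgue.

Section random.
Context {disp : measure_display} {Omega : measurableType disp} {R : realType}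
  {P : probability Omega R}.

Definition mutually_independent {disp' : measure_display}
    {T : measurableType disp'} {n : nat} (X : 'I_n -> {RV P >-> T}) : Prop :=
  forall (J : {set 'I_n}) (E : 'I_n -> set T),
    (forall i, measurable (E i)) ->
    P (\bigcap_(i in [set` J]) (X i @^-1` E i)) =
    (\prod_(i in J) P (X i @^-1` E i))%E.

(* The law of X is determined by its values on Borel sets, so B may be any
   Lebesgue measurable set of positive measure. *)
Definition uniform_on {d : nat} (X : {RV P >-> torus R d})
    (B : set (torus R d)) : Prop :=
  forall E : set (torus R d), measurable E ->
    P (X @^-1` E) = (vol (E `&` B) / vol B)%:E.

End random.

(* Main.v *)
(* For x in the torus put F(x) = |B ∩ (x - A)|. A point x is missed by the
   union of the A + b_i with probability (1 - F(x)/|B|)^n, so the expectation is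
   the integral of phi(F) where phi(y) = 1 - (1 - y/|B|)^n is concave. Such a phi
   is a positive mixture of the identity and of the functions min(_, t), so the
   bound follows from Pollard's inequality
     ∫ min(F, t) >= t min(|A| + |B| - t, 1)    for 0 <= t <= min(|A|, |B|).
   For fixed B and t the functional c(A) = ∫ min(F, t) - t |A| is translation
   invariant and submodular. Since |A ∩ (A + h)| varies continuously with h, the
   infimum of c over the sets of measure a is a concave function of a, and on
   the range t <= a <= 1 - |B| + t Pollard's inequality only has to be checked
   at the two endpoints, where it is immediate. *)
Require Import Defs.
From mathcomp Require Import all_boot all_order all_algebra.
From mathcomp Require Import ring_quotient lra ring.
From mathcomp Require Import all_classical all_reals all_analysis.
From mathcomp Require Import measurable_realfun.
Import Order.TTheory GRing.Theory Num.Theory.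
Import numFieldNormedType.Exports.

Set Implicit Arguments.
Unset Strict Implicit.
Unset Printing Implicit Defensive.

Local Open Scope classical_set_scope.
Local Open Scope ring_scope.

(** * The circle *)

Section circle.
Variable R : realType.
Local Notation lambda := (@lebesgue_measure R).
Implicit Types (x y : R) (h u : circle R).

(** Submodularity for A and A + h relates A to two sets of measure |A| - D and |A| + D, where D = |A
    \ (A + h)|. This yields concavity only if D can be made small without vanishing. For that, h
    runs through the successive halves of one vector that displaces A substantially; continuity is
    used only along this sequence. The infimum over sets of given measure may fail to be attained,
    so none is ever taken: a counterexample is replaced again and again by one that is better by a
    fixed amount, until a lower bound is violated.

    Endpoints: if |A| = t, then F <= |A| gives min(F, t) = F, with integral |A| |B| = t |B|. If |A|
    = 1 - |B| + t, then F >= |A| + |B| - 1 = t everywhere, and the integral is t. Both times c(A) =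
    t (|B| - t), which is also what Pollard's bound becomes once t |A| is subtracted.

    Lebesgue measurable sets are first replaced by Borel subsets of the same measure, so that
    Tonelli is applied to Borel sets only. *)

Definition frac y : R := y - (Num.floor y)%:~R.

Lemma frac_itv y : 0 <= frac y < 1.
Proof.
rewrite /frac; have := floor_le y; have := floorD1_gt y.
by rewrite intrD; lra.
Qed.

Lemma measurable_frac : measurable_fun [set: R] frac.
Proof.
apply: measurable_funB => //; apply: nondecreasing_measurable => //.
by move=> x y xy; rewrite ler_int le_floor.
Qed.

Lemma circle_pi_eq x y : circle_pi x = circle_pi y <-> x - y \is a Num.int.
Proof.
rewrite /circle_pi; split.
  by move=> /eqP; rewrite -Quotient.idealrBE.
move=> xy; apply/eqP.
by rewrite -Quotient.idealrBE.
Qed.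

Lemma circle_piD x y : circle_pi (x + y) = circle_pi x + circle_pi y.
Proof. exact: (raddfD (\pi_(circle R)%qT)). Qed.

Lemma circle_piN x : circle_pi (- x) = - circle_pi x.
Proof. exact: (raddfN (\pi_(circle R)%qT)). Qed.

(** [repr] picks an arbitrary representative; its fractional part is canonical, hence measurable.
    The group operations are then seen to be measurable by lifting them to the line. *)
Definition circle_sec h : R := frac (repr h).

Lemma circle_pi_frac y : circle_pi (frac y) = circle_pi y.
Proof.
by apply/circle_pi_eq; rewrite /frac addrAC subrr add0r rpredN intr_int.
Qed.

Lemma circle_secK h : circle_pi (circle_sec h) = h.
Proof. by rewrite circle_pi_frac /circle_pi reprK. Qed.

Lemma frac_eq x y : x - y \is a Num.int -> frac x = frac y.
Proof.
move=> /intrP[m xy]; have -> : x = y + m%:~R by rewrite -xy addrC subrK.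
by rewrite /frac floorDrz// intrKfloor intrD; lra.
Qed.

Lemma circle_sec_pi y : circle_sec (circle_pi y) = frac y.
Proof. by apply: frac_eq; apply/circle_pi_eq; rewrite /circle_pi reprK. Qed.

Lemma measurable_circle_sec : measurable_fun [set: circle R] circle_sec.
Proof.
move=> _ F mF; rewrite setTI /measurable/= /circle_measurable/=.
rewrite -comp_preimage (_ : _ \o _ = @frac).
  by rewrite -[X in measurable X]setTI; exact: measurable_frac.
by apply/funext => y/=; rewrite circle_sec_pi.
Qed.

Lemma measurable_circleD :
  measurable_fun [set: circle R * circle R] (fun z => z.1 + z.2).
Proof.
rewrite (_ : (fun z => _) = fun z => circle_pi (circle_sec z.1 + circle_sec z.2)).
  apply: measurableT_comp; first exact: measurable_circle_pi.
  by apply: measurable_funD; apply: measurableT_comp => //;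
    exact: measurable_circle_sec.
by apply/funext => z; rewrite circle_piD !circle_secK.
Qed.

Lemma measurable_circle_shift h :
  measurable_fun [set: circle R] (fun u => u + h).
Proof.
apply: (measurableT_comp (f := fun z : circle R * circle R => z.1 + z.2)
  measurable_circleD (g := fun u => (u, h))).
exact: measurable_fun_pair.
Qed.

Lemma measurable_circleN : measurable_fun [set: circle R] (fun z => - z).
Proof.
rewrite (_ : (fun z => _) = fun z => circle_pi (- circle_sec z)).
  apply: measurableT_comp; first exact: measurable_circle_pi.
  by apply: measurable_funN; exact: measurable_circle_sec.
by apply/funext => z; rewrite circle_piN !circle_secK.
Qed.

Lemma lebesgue_measure_shift (c : R) (A : set (measurableTypeR R)) :
  measurable A -> lambda ((fun x => x + c) @^-1` A) = lambda A.
Proof.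
pose shiftc : measurableTypeR R -> measurableTypeR R := fun x => x + c.
have mc : measurable_fun [set: measurableTypeR R] shiftc by exact: measurable_funD.
move=> mA; symmetry.
apply: (@lebesgue_measure_unique R (pushforward lambda shiftc)) => //.
move=> X [[a b] _ <-].
rewrite /pushforward/=.
transitivity (lambda `]a - c, b - c]%classic).
  rewrite !lebesgue_measure_itv/= !lte_fin ltrD2r; case: ifPn => // _.
  by rewrite -!EFinD; congr EFin; lra.
congr (lebesgue_measure _); apply/seteqP.
by split => x/=; rewrite /shiftc !in_itv/= ltrBlDr lerBrDr.
Qed.

(** The uniform law lives on the closed interval; removing the null endpoint 1 leaves a fundamental
    domain of the projection. *)
Lemma circle_haarE (E : set (circle R)) : measurable E ->
  circle_haar R E = lambda ((@circle_pi R) @^-1` E `&` `[0, 1[).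
Proof.
move=> mE; rewrite /circle_haar /distribution/= /pushforward /uniform_prob.
rewrite integral_uniform_pdf.
have mpE : measurable ((@circle_pi R) @^-1` E : set (measurableTypeR R)) by [].
rewrite (eq_integral (fun=> 1%:E)); last first.
  move=> x; rewrite inE/= => -[_]; rewrite in_itv/= /uniform_pdf => ->.
  by rewrite subr0 invr1.
rewrite integral_cst//=; last exact: measurableI.
set F := (@circle_pi R) @^-1` E.
rewrite mul1e.
transitivity (lambda ((F `&` `[0, 1[) `|` (F `&` [set 1]))).
  congr (lebesgue_measure _); apply/seteqP; split => x/=; rewrite !in_itv/=.
    move=> [Fx /andP[x0]]; rewrite le_eqVlt => /predU1P[x1|x1].
      by right.
    by left; rewrite x0.
  move=> [[Fx /andP[x0 x1]]|[Fx x1]]; split => //; first by rewrite x0 ltW.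
  by rewrite x1 ler01 lexx.
apply: measureU0; [exact: measurableI|exact: measurableI|].
apply/eqP; rewrite -measure_le0 -[leRHS](lebesgue_measure_set1 1).
by apply: le_measure; rewrite ?inE//; exact: measurableI.
Qed.

(** The preimage of [E] is 1-periodic, so [[0, c[] and [[1, 1 + c[] carry the same finite measure of
    it. Cutting [[0, 1 + c[] once at [c] and once at 1 and cancelling these pieces compares the
    windows [[c, 1 + c[] and [[0, 1[]. *)
Lemma circle_haar_shift h (E : set (circle R)) : measurable E ->
  circle_haar R ((fun u => u + h) @^-1` E) = circle_haar R E.
Proof.
move=> mE.
have mEh : measurable ((fun u => u + h) @^-1` E).
  by rewrite -[X in measurable X]setTI; exact: measurable_circle_shift.
rewrite !circle_haarE//.
set c := circle_sec h; set F := (@circle_pi R) @^-1` E.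
have mF : measurable (F : set (measurableTypeR R)) by [].
have /andP[c0 c1] : 0 <= c < 1 by exact: frac_itv.
have FD1 x : F (x + 1) = F x.
  rewrite /F/= (_ : circle_pi (x + 1) = circle_pi x)//.
  by apply/circle_pi_eq; rewrite addrAC subrr add0r rpred1.
have split_itv a b : 0 <= a <= b ->
    lambda (F `&` `[0, b[) = (lambda (F `&` `[0%R, a[) + lambda (F `&` `[a, b[))%E.
  move=> /andP[a0 ab]; rewrite -measureU//; last 3 first.
  - exact: measurableI.
  - exact: measurableI.
  - apply/seteqP; split => // x/=; rewrite !in_itv/=.
    by move=> -[[_ /andP[_ xa]] [_ /andP[]]]; lra.
  congr lambda; rewrite -setIUr; congr (_ `&` _).
  apply/seteqP; split => x/=; rewrite !in_itv/=.
    by move=> /andP[-> ->]; rewrite andbT/=; case: (ltP x a) => ?; [left|right].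
  by move=> [] /andP[]; lra.
transitivity (lambda (F `&` `[c, 1 + c[)).
  rewrite -[RHS](lebesgue_measure_shift c); last exact: measurableI.
  congr lambda; apply/seteqP.
  split => x/=; rewrite !in_itv/= /F/= circle_piD circle_secK.
    by move=> [? /andP[? ?]]; split => //; lra.
  by move=> [? /andP[? ?]]; split => //; lra.
have e0c : lambda (F `&` `[1, 1 + c[) = lambda (F `&` `[0, c[).
  rewrite -[LHS](lebesgue_measure_shift 1); last exact: measurableI.
  congr lambda; apply/seteqP; split => x/=; rewrite !in_itv/= FD1.
    by move=> [? /andP[? ?]]; split => //; lra.
  by move=> [? /andP[? ?]]; split => //; lra.
have fin b : lambda (F `&` `[0, b[) \is a fin_num.
  rewrite ge0_fin_numE//; apply: (@le_lt_trans _ _ (lambda `[0, b[)).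
    by apply: le_measure; rewrite ?inE//; exact: measurableI.
  by rewrite lebesgue_measure_itv/=; case: ifPn => // _; rewrite -EFinD ltry.
have := split_itv 1 (1 + c); rewrite (split_itv c) ?e0c; last by apply/andP; lra.
move=> /(_ _)/wrap[]; first by apply/andP; lra.
rewrite addeC => split01.
have := congr1 (fun z => (z - lambda (F `&` `[0%R, c[))%E) split01.
by rewrite /= !addeK.
Qed.

End circle.

(** * Haar measure on the torus *)

Section torus.
Variable R : realType.

Lemma tnth_torusD d (x y : torus R d) i : tnth (x + y) i = tnth x i + tnth y i.
Proof. exact: tnth_mktuple. Qed.

Lemma tnth_torusN d (x : torus R d) i : tnth (- x) i = - tnth x i.
Proof. exact: tnth_mktuple. Qed.

Lemma measurable_torusD d :
  measurable_fun [set: torus R d * torus R d] (fun z => z.1 + z.2).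
Proof.
apply/measurable_fun_tnthP => i /=.
rewrite (_ : _ \o _ = (fun z : circle R * circle R => z.1 + z.2) \o
    (fun z : torus R d * torus R d => (tnth z.1 i, tnth z.2 i))); last first.
  by apply/funext => z /=; rewrite tnth_torusD.
apply: measurableT_comp; first exact: measurable_circleD.
by apply: measurable_fun_pair; apply: (measurableT_comp (measurable_tnth i)).
Qed.

Lemma measurable_torusN d : measurable_fun [set: torus R d] (fun x => - x).
Proof.
apply/measurable_fun_tnthP => i /=.
rewrite (_ : _ \o _ = (fun u : circle R => - u) \o
    (fun x : torus R d => tnth x i)); last first.
  by apply/funext => z /=; rewrite tnth_torusN.
apply: measurableT_comp; first exact: measurable_circleN.
exact: measurable_tnth.
Qed.

Lemma measurable_torusB d :
  measurable_fun [set: torus R d * torus R d] (fun z => z.1 - z.2).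
Proof.
have mN : measurable_fun setT (fun z : torus R d * torus R d => (z.1, - z.2)).
  apply: measurable_fun_pair => //.
  exact: (measurableT_comp (@measurable_torusN d) measurable_snd).
exact: (measurableT_comp (@measurable_torusD d) mN).
Qed.

Lemma measurable_torus_shift d (h : torus R d) :
  measurable_fun [set: torus R d] (fun x => x + h).
Proof.
have mh : measurable_fun setT (fun x : torus R d => (x, h)).
  exact: measurable_fun_pair.
exact: (measurableT_comp (@measurable_torusD d) mh).
Qed.

Lemma torus_consD d (z w : circle R * torus R d) :
  torus_cons (z.1 + w.1, z.2 + w.2) = torus_cons z + torus_cons w.
Proof.
apply: eq_from_tnth => i; rewrite tnth_torusD /torus_cons.
case: (unliftP ord0 i) => [j ->|->]/=; first by rewrite !tnthS tnth_torusD.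
by rewrite !tnth0.
Qed.

Lemma torus_cons_surj d (h : torus R d.+1) :
  exists w : circle R * torus R d, h = torus_cons w.
Proof. by case/tupleP: h => h0 h; exists (h0, h). Qed.

(** By uniqueness of the product measure it suffices to compare rectangles, on which the shift acts
    factor by factor. *)
Lemma torus_haar_shift d (h : torus R d) (E : set (torus R d)) : measurable E ->
  torus_haar R d ((fun x => x + h) @^-1` E) = torus_haar R d E.
Proof.
elim: d => [|d IH] in h E *.
  by move=> _; congr (torus_haar R 0 _); apply/seteqP; split => x /=;
    rewrite (_ : x + h = x)//; apply: eq_from_tnth => -[].
move=> mE; have [w ->] := torus_cons_surj h.
pose s (z : circle R * torus R d) := (z.1 + w.1, z.2 + w.2).
have ms : measurable_fun setT s.
  apply: measurable_fun_pair.
    exact: (measurableT_comp (@measurable_circle_shift _ w.1) measurable_fst).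
  exact: (measurableT_comp (@measurable_torus_shift _ w.2) measurable_snd).
pose P := (circle_haar R \x torus_haar R d)%E.
have mcE : measurable (@torus_cons R d @^-1` E).
  by rewrite -[X in measurable X]setTI; exact: measurable_torus_cons.
transitivity (pushforward P s (@torus_cons R d @^-1` E)).
  rewrite /= /distribution /pushforward; congr (product_measure1 _ _ _).
  by apply/seteqP; split => z/=; rewrite torus_consD.
rewrite -(@product_measure_unique _ _ _ _ _ (circle_haar R) (torus_haar R d)
  (pushforward P s))//.
move=> A B mA mB.
transitivity (P (((fun u => u + w.1) @^-1` A) `*` ((fun x => x + w.2) @^-1` B))).
  by [].
rewrite /P product_measure1E.
- by congr (_ * _)%E; [exact: circle_haar_shift|exact: IH].
- by rewrite -[X in measurable X]setTI; exact: measurable_circle_shift.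
- by rewrite -[X in measurable X]setTI; exact: measurable_torus_shift.
Qed.

Lemma torus_haar_coord d (i : 'I_d) (E : set (circle R)) : measurable E ->
  torus_haar R d ((fun x => tnth x i) @^-1` E) = circle_haar R E.
Proof.
elim: d => [|d IH] in i *; first by case: i.
move=> mE; case: (unliftP ord0 i) => [j ->|->].
  transitivity ((circle_haar R \x torus_haar R d)%E
      (setT `*` ((fun x => tnth x j) @^-1` E))).
    rewrite /= /distribution /pushforward; congr (product_measure1 _ _ _).
    by apply/seteqP; split => z/=; rewrite tnthS//; case.
  have mj : measurable ((fun x : torus R d => tnth x j) @^-1` E).
    by rewrite -[X in measurable X]setTI; exact: measurable_tnth.
  rewrite product_measure1E// [X in (X * _)%E]probability_setT mul1e.
  exact: IH.
transitivity ((circle_haar R \x torus_haar R d)%E (E `*` setT)).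
  rewrite /= /distribution /pushforward; congr (product_measure1 _ _ _).
  by apply/seteqP; split => z/=; rewrite tnth0//; case.
by rewrite product_measure1E// [X in (_ * X)%E]probability_setT mule1.
Qed.

End torus.

(** * Continuity of translations *)

Section fprob.
Context {dsp : measure_display} {T : measurableType dsp} {R : realType}
  (mu : probability T R).
Implicit Types A B : set T.

Definition fprob A : R := fine (mu A).

Lemma fprobE A : measurable A -> (fprob A)%:E = mu A.
Proof. by move=> mA; rewrite fineK// fin_num_measure. Qed.

Lemma fprob_ge0 A : 0 <= fprob A.
Proof. exact: fine_ge0. Qed.

Lemma fprob0 : fprob set0 = 0.
Proof. by rewrite /fprob measure0. Qed.

Lemma fprobT : fprob setT = 1.
Proof. by rewrite /fprob probability_setT. Qed.

Lemma fprob_le A B : measurable A -> measurable B -> A `<=` B ->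
  fprob A <= fprob B.
Proof.
move=> mA mB AB; rewrite fine_le ?fin_num_measure//.
by apply: le_measure; rewrite ?inE.
Qed.

Lemma fprob_le1 A : measurable A -> fprob A <= 1.
Proof. by move=> mA; rewrite -fprobT; exact: fprob_le. Qed.

Lemma fprobUI A B : measurable A -> measurable B ->
  fprob (A `|` B) + fprob (A `&` B) = fprob A + fprob B.
Proof.
move=> mA mB; have mAB : measurable (A `&` B) by exact: measurableI.
have [fA fB fAB] : [/\ mu A \is a fin_num, mu B \is a fin_num &
    mu (A `&` B) \is a fin_num] by split; exact: fin_num_measure.
rewrite /fprob measureUfinl//; last by rewrite ltey_eq fA.
by rewrite fineB ?fineD ?subrK// fin_numD fA.
Qed.

Lemma fprobU_le A B : measurable A -> measurable B ->
  fprob (A `|` B) <= fprob A + fprob B.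
Proof. by move=> mA mB; rewrite -fprobUI// lerDl fprob_ge0. Qed.

Lemma fprobD A B : measurable A -> measurable B ->
  fprob (A `\` B) = fprob A - fprob (A `&` B).
Proof.
move=> mA mB; rewrite /fprob measureD//; last by rewrite ltey_eq fin_num_measure.
by rewrite fineB// fin_num_measure//; exact: measurableI.
Qed.

End fprob.

Section translation_sigma_algebra.
Context {dsp : measure_display} {T : measurableType dsp} {R : realType}
  (mu : probability T R) (tau : nat -> T -> T).
Hypothesis mtau : forall k, measurable_fun setT (tau k).
Hypothesis tau_mu : forall k A, measurable A -> mu (tau k @^-1` A) = mu A.
Local Notation V := (fprob mu).

(** Half of the symmetric difference is enough: [tau k] preserves [mu], so the other half has the
    same measure. This is also why the class is stable under complement. *)
Definition asymptotically_invariant : set (set T) :=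
  [set A | measurable A /\
    forall e, 0 < e -> \forall k \near \oo, V (A `\` tau k @^-1` A) < e].

Let mpre k A : measurable A -> measurable (tau k @^-1` A).
Proof. by move=> mA; rewrite -[X in measurable X]setTI; exact: mtau. Qed.

Let asymptotically_invariantU A B : asymptotically_invariant A ->
  asymptotically_invariant B -> asymptotically_invariant (A `|` B).
Proof.
move=> [mA hA] [mB hB]; split; first exact: measurableU.
move=> e e0; have e20 : 0 < e / 2 by lra.
near=> k.
have kA : V (A `\` tau k @^-1` A) < e / 2 by near: k; exact: hA.
have kB : V (B `\` tau k @^-1` B) < e / 2 by near: k; exact: hB.
apply: (@le_lt_trans _ _ (V ((A `\` tau k @^-1` A) `|` (B `\` tau k @^-1` B)))).
  apply: fprob_le.
  - by apply: measurableD; [exact: measurableU|apply: mpre; exact: measurableU].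
  - by apply: measurableU; apply: measurableD => //; exact: mpre.
  - by move=> x [[Ax|Bx] /not_orP[nA nB]]; [left|right].
have mA' : measurable (A `\` tau k @^-1` A).
  by apply: measurableD => //; exact: mpre.
have mB' : measurable (B `\` tau k @^-1` B).
  by apply: measurableD => //; exact: mpre.
by have := fprobU_le mu mA' mB'; lra.
Unshelve. all: by end_near. Qed.

(** Thanks to this, convergence has to be checked only on generators of the sigma-algebra. *)
Lemma asymptotically_invariant_sigma_algebra :
  sigma_algebra setT asymptotically_invariant.
Proof.
split.
- split => // e e0; near=> k.
  by rewrite set0D fprob0.
- move=> A [mA hA]; rewrite setTD; split; first exact: measurableC.
  move=> e /hA; apply: filterS => k.
  have mtA := mpre k mA.
  rewrite (_ : ~` A `\` _ = tau k @^-1` A `\` A); last first.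
    by rewrite preimage_setC [LHS]setDE setCK setIC -setDE.
  by rewrite !fprobD// setIC /fprob tau_mu.
- move=> F hF.
  have mF k : measurable (F k) by have [] := hF k.
  pose G N := \big[setU/set0]_(i < N.+1) F i.
  have hG N : asymptotically_invariant (G N).
    rewrite /G; elim: N.+1 => {N} [|N IH].
      rewrite big_ord0; split => // e e0; near=> k.
      by rewrite set0D fprob0.
    by rewrite big_ord_recr/=; exact: asymptotically_invariantU.
  have mG N : measurable (G N) by have [] := hG N.
  have mUF : measurable (\bigcup_i F i) by exact: bigcupT_measurable.
  split => // e e0; have e20 : 0 < e / 2 by lra.
  have GUF N : G N `<=` \bigcup_i F i.
    by rewrite /G -bigcup_mkord => x [i _ Fx]; exists i.
  (* Continuity from below: a finite union exhausts the countable one up to [e / 2], with [N]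
     independent of [k]. *)
  have [N hN] : exists N, V ((\bigcup_i F i) `\` G N) < e / 2.
    have : mu (G N) @[N --> \oo] --> mu (\bigcup_i F i).
      have UG : \bigcup_i F i = \bigcup_i G i by rewrite bigcup_bigsetU_bigcup.
      rewrite UG; apply: (@nondecreasing_cvg_mu _ _ _ mu G) => //.
      - exact: bigcupT_measurable.
      - by move=> m n mn; apply/subsetPset; exact: subset_bigsetU.
    rewrite -[X in _ --> X]fprobE// => /fine_cvg.
    move=> /cvgrPdist_lt/(_ _ e20)[N _ hN].
    exists N; rewrite fprobD// (setIidr (GUF N)).
    by have /= := hN N (leqnn N); rewrite ltr_norml => /andP[].
  have := (hG N).2 _ e20; apply: filterS => k hk.
  apply: (@le_lt_trans _ _
    (V (((\bigcup_i F i) `\` G N) `|` (G N `\` tau k @^-1` G N)))).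
    apply: fprob_le.
    - by apply: measurableD => //; exact: mpre.
    - by apply: measurableU; apply: measurableD => //; exact: mpre.
    - move=> x [Ux nUx]; have [Gx|nGx] := pselect (G N x); last by left.
      by right; split => // Gt; apply: nUx; exact: (GUF N).
  have m1 : measurable ((\bigcup_i F i) `\` G N) by exact: measurableD.
  have m2 : measurable (G N `\` tau k @^-1` G N).
    by apply: measurableD => //; exact: mpre.
  by have := fprobU_le mu m1 m2; lra.
Unshelve. all: by end_near. Qed.

End translation_sigma_algebra.

Section translation_continuity.
Variable R : realType.
Local Notation lambda := (@lebesgue_measure R).

Lemma frac_id (y : R) : 0 <= y < 1 -> frac y = y.
Proof.
by move=> y01; rewrite /frac (@floor_def _ _ 0) ?subr0// add0r.
Qed.

(** A point of the ray leaves it under the shift by [c] either by wrapping around 0, so it lies in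
    [[0, c]], or by crossing [r], so it lies in [[r, r + c]]. *)
Lemma circle_ray_shift (c r : R) : 0 <= c <= 1 ->
  (circle_haar R ([set u | (r <= circle_sec u)%R] `\`
     [set u | (r <= circle_sec (u - circle_pi c))%R]) <= (2 * c)%:E)%E.
Proof.
move=> /andP[c0 c1].
have msec := @measurable_circle_sec R.
have mray : measurable [set u : circle R | r <= circle_sec u].
  rewrite [X in measurable X](_ : _ = setT `&` (@circle_sec R) @^-1` `[r, +oo[).
    exact: msec.
  by rewrite setTI; apply/seteqP; split => u/=; rewrite in_itv/= andbT.
have mray' : measurable [set u : circle R | r <= circle_sec (u - circle_pi c)].
  have := @measurable_circle_shift R (- circle_pi c) measurableT _ mray.
  by rewrite setTI.
have mD := measurableD mray mray'.
rewrite circle_haarE//; set F := _ @^-1` _.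
have mF : measurable (F : set (measurableTypeR R)) by [].
apply: (@le_trans _ _ (lambda (`[0%R, c] `|` `[r, (r + c)%R]))).
  apply: le_measure; rewrite ?inE//.
  - exact: measurableI.
  - exact: measurableU.
  - move=> y [] [/=]; rewrite -circle_piN -circle_piD !circle_sec_pi !in_itv/=.
    move=> ry /negP; rewrite -ltNge => yr y01; move: ry; rewrite frac_id// => ry.
    have [yc|cy] := leP y c; first by left; lra.
    by right; move: yr; rewrite frac_id//; lra.
apply: (le_trans (measureU2 _ _ _)) => //.
have itvE (a : R) : (lambda `[a, (a + c)%R] <= c%:E)%E.
  rewrite lebesgue_measure_itv/= lte_fin; case: ifPn => _; last by rewrite lee_fin.
  by rewrite -EFinD lee_fin addrAC subrr add0r.
rewrite (_ : 2 * c = c + c); last by lra.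
by rewrite EFinD; apply: leeD; [have := itvE 0; rewrite add0r|exact: itvE].
Qed.

Definition translation d (h : torus R d) (A : set (torus R d)) : set (torus R d) :=
  (fun x => x - h) @^-1` A.

Lemma measurable_translation d (h : torus R d) A :
  measurable A -> measurable (translation h A).
Proof.
by move=> mA; rewrite -[X in measurable X]setTI; exact: measurable_torus_shift.
Qed.

Lemma torus_haar_translation d (h : torus R d) A :
  measurable A -> torus_haar R d (translation h A) = torus_haar R d A.
Proof. exact: torus_haar_shift. Qed.

(** A coherent sequence of halves of [v] tending to 0, obtained by dividing the lifts in [[0, 1[] by
    powers of 2. Through it the divisibility of the torus enters the proof. *)
Definition dyadic_part d (v : torus R d) k : torus R d :=
  [tuple circle_pi (circle_sec (tnth v i) / 2 ^+ k) | i < d].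

Lemma dyadic_part0 d (v : torus R d) : dyadic_part v 0 = v.
Proof.
by apply: eq_from_tnth => i; rewrite tnth_mktuple expr0 divr1 circle_secK.
Qed.

Lemma dyadic_partS d (v : torus R d) k :
  dyadic_part v k.+1 + dyadic_part v k.+1 = dyadic_part v k.
Proof.
apply: eq_from_tnth => i; rewrite tnth_torusD !tnth_mktuple -circle_piD exprS.
by congr circle_pi; field.
Qed.

(** The sigma-algebra is generated by the coordinates, and each coordinate is read through
    [circle_sec]; hence preimages of rays [[r, +oo[] suffice, and for these the displacement is
    explicit. *)
Lemma translation_dyadic_cvg d (v : torus R d) (A : set (torus R d)) :
  measurable A ->
  asymptotically_invariant (torus_haar R d) (fun k x => x - dyadic_part v k) A.
Proof.
set AI := asymptotically_invariant _ _.
have sAI : sigma_algebra setT AI.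
  apply: asymptotically_invariant_sigma_algebra.
    by move=> k; exact: measurable_torus_shift.
  by move=> k B; exact: torus_haar_shift.
suff gen (i : 'I_d) (E : set (circle R)) : measurable E ->
    AI ((fun x => tnth x i) @^-1` E).
  apply: smallest_sub => // B.
  rewrite -bigcup_seq/= => -[i _ [E mE <-]].
  by rewrite setTI; exact: gen.
move=> mE.
rewrite (_ : (fun x => tnth x i) @^-1` E =
  (fun x => circle_sec (tnth x i)) @^-1` (@circle_pi R @^-1` E)); last first.
  by apply/seteqP; split => x/=; rewrite circle_secK.
have : measurable (@circle_pi R @^-1` E : set (measurableTypeR R)) by [].
move: (_ @^-1` E) => F.
rewrite [X in X -> _](_ : _ = (@RGenCInfty.G R).-sigma.-measurable F); last first.
  by rewrite -RGenCInfty.measurableE.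
move: F; apply: smallest_sub.
  have [s0 sC sU] := sAI; split => /=.
  - by rewrite preimage_set0.
  - move=> F /sC; rewrite !setTD; exact: id.
  - by move=> F hF; rewrite preimage_bigcup; exact: sU.
move=> _ [r ->].
pose ray : set (circle R) := [set u | r <= circle_sec u].
have -> : (fun x : torus R d => circle_sec (tnth x i)) @^-1` `[r, +oo[ =
    (fun x => tnth x i) @^-1` ray.
  by apply/seteqP; split => x/=; rewrite in_itv/= andbT.
have mray : measurable ray.
  rewrite (_ : ray = setT `&` (@circle_sec R) @^-1` `[r, +oo[).
    exact: measurable_circle_sec.
  by rewrite setTI; apply/seteqP; split => u/=; rewrite in_itv/= andbT.
have mtnth (B : set (circle R)) : measurable B ->
    measurable ((fun x : torus R d => tnth x i) @^-1` B).
  by move=> mB; rewrite -[X in measurable X]setTI; exact: measurable_tnth.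
split; first exact: mtnth.
move=> e e0; have e20 : 0 < e / 2 by lra.
(* The displacement is at most [2 * c], hence the [e / 2]; and [c] is at most the inverse of [k.+1]
   because [k.+1 <= 2 ^ k]. *)
have := @near_infty_natSinv_lt R (PosNum e20); apply: filterS => k ke.
have {}ke : k.+1%:R^-1 < e / 2 by exact: ke.
have /andP[v0 v1] : 0 <= circle_sec (tnth v i) < 1 by exact: frac_itv.
pose c := circle_sec (tnth v i) / 2 ^+ k.
have kpos : 0 < k.+1%:R :> R by rewrite ltr0n.
have pow_gt0 : 0 < 2 ^+ k :> R by rewrite exprn_gt0.
have c_le : c <= k.+1%:R^-1.
  rewrite /c ler_pdivrMr//; apply: (le_trans (ltW v1)).
  by rewrite mulrC ler_pdivlMr// mul1r -natrX ler_nat ltn_expl.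
have kinv1 : k.+1%:R^-1 <= 1 :> R by rewrite invf_le1// ler1n.
have c01 : 0 <= c <= 1.
  by rewrite (le_trans c_le kinv1) andbT /c divr_ge0// ltW.
have mrayc : measurable [set u : circle R | r <= circle_sec (u - circle_pi c)].
  have := @measurable_circle_shift R (- circle_pi c) measurableT _ mray.
  by rewrite setTI.
rewrite (_ : _ `\` _ = (fun x : torus R d => tnth x i) @^-1`
   (ray `\` [set u | r <= circle_sec (u - circle_pi c)])); last first.
  apply/seteqP; split => x/=; rewrite tnth_torusD tnth_torusN tnth_mktuple;
    exact: id.
rewrite /fprob torus_haar_coord -/(fprob _ _); last exact: measurableD.
apply: (@le_lt_trans _ _ (2 * c)); last by have := le_lt_trans c_le ke; lra.
rewrite -lee_fin fprobE ?circle_ray_shift//.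
exact: measurableD.
Qed.

End translation_continuity.

(** * Convolutions *)

Section sections.
Context {d1 d2 : measure_display} {T1 : measurableType d1}
  {T2 : measurableType d2} {R : realType}.
Variables (m1 : probability T1 R) (m2 : probability T2 R).
Variable S : set (T1 * T2).
Hypothesis mS : measurable S.

Lemma measurable_section x : measurable [set y | S (x, y)].
Proof.
rewrite (_ : [set y | _] = xsection S x); first exact: measurable_xsection.
by apply/seteqP; split => y /=; rewrite /xsection/= inE.
Qed.

Lemma measurable_fun_prob_section :
  measurable_fun setT (fun x => fprob m2 [set y | S (x, y)]).
Proof.
rewrite (_ : (fun x => _) = fine \o (m2 \o xsection S)); last first.
  apply/funext => x /=; congr (fine (m2 _)).
  by apply/seteqP; split => y /=; rewrite /xsection/= inE.
apply: measurableT_comp; first exact: fine_measurable.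
exact: measurable_fun_xsection.
Qed.

Lemma integral_section_swap :
  (\int[m1]_x m2 [set y | S (x, y)] = \int[m2]_y m1 [set x | S (x, y)])%E.
Proof.
have := indic_fubini_tonelli m1 m2 mS.
rewrite indic_fubini_tonelli_FE// indic_fubini_tonelli_GE//= => FG.
transitivity (\int[m1]_x m2 (xsection S x))%E; last rewrite FG.
  apply: eq_integral => x _; congr (m2 _).
  by apply/seteqP; split => y /=; rewrite /xsection/= inE.
apply: eq_integral => y _; congr (m1 _).
by apply/seteqP; split => x /=; rewrite /ysection/= inE.
Qed.

End sections.

Section bounded_Rintegral.
Context {dsp : measure_display} {T : measurableType dsp} {R : realType}
  (mu : probability T R).
Implicit Type f : T -> R.

Lemma bounded_integrable f (M : R) : measurable_fun setT f ->
  (forall x, `|f x| <= M) -> mu.-integrable setT (EFin \o f).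
Proof.
move=> mf fM; apply: measurable_bounded_integrable => //.
  by rewrite ltey_eq fin_num_measure.
exists M; split; first exact: num_real.
by move=> y My x _ /=; exact: (le_trans (fM x) (ltW My)).
Qed.

Lemma Rintegral_prob_cst (r : R) : \int[mu]_x r = r.
Proof. by rewrite Rintegral_cst// -/(fprob _ _) fprobT mulr1. Qed.

End bounded_Rintegral.

Section convolution.
Context {R : realType} {d : nat}.
Local Notation T := (torus R d).
Local Notation mu := (torus_haar R d).
Local Notation V := (fprob mu).
Implicit Types (A B : set T) (x h : T) (t : R).

(** The function F of the overview: the convolution of the two indicators. *)
Definition conv A B x : R := V (B `&` [set y | A (x - y)]).

Let graph A B : set (T * T) := [set z | B z.2 /\ A (z.1 - z.2)].

Let measurable_graph A B : measurable A -> measurable B ->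
  measurable (graph A B).
Proof.
move=> mA mB; apply: measurableI.
  by rewrite -[X in measurable X]setTI; exact: measurable_snd.
by rewrite -[X in measurable X]setTI; exact: measurable_torusB.
Qed.

Lemma measurable_conv_set A B x : measurable A -> measurable B ->
  measurable (B `&` [set y | A (x - y)]).
Proof.
by move=> mA mB; exact: (measurable_section (measurable_graph mA mB)).
Qed.

Lemma measurable_conv A B : measurable A -> measurable B ->
  measurable_fun setT (conv A B).
Proof.
move=> mA mB.
exact: (measurable_fun_prob_section mu (measurable_graph mA mB)).
Qed.

Lemma integral_conv A B : measurable A -> measurable B ->
  (\int[mu]_x (conv A B x)%:E = mu A * mu B)%E.
Proof.
move=> mA mB.
transitivity (\int[mu]_x mu (B `&` [set y | A (x - y)%R]))%E.
  by apply: eq_integral => x _; rewrite fprobE//; exact: measurable_conv_set.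
rewrite (integral_section_swap mu mu (measurable_graph mA mB)).
(* For fixed [y], the section in [x] is a translate of [A] when [y] is in [B], and empty
   otherwise. *)
rewrite (eq_integral (fun y => mu A * (\1_B y)%:E)%E); last first.
  move=> y _; rewrite indicE /graph/=; have [yB|yB] := boolP (y \in B).
    rewrite mule1 -(torus_haar_translation y mA); congr (mu _).
    apply/seteqP; split => x/=; first by case.
    by split => //; exact/set_mem.
  rewrite mule0 -(measure0 mu); congr (mu _); apply/seteqP; split => x //= [By _].
  by move/negP: yB; apply; exact/mem_set.
rewrite ge0_integralZl//; last first.
  by apply/measurable_EFinP; exact: measurable_indic.
by rewrite integral_indic// setIT.
Qed.

Lemma conv_ge0 A B x : 0 <= conv A B x.
Proof. exact: fprob_ge0. Qed.

Lemma conv_le_r A B x : measurable A -> measurable B -> conv A B x <= V B.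
Proof.
by move=> mA mB; apply: fprob_le => //; exact: measurable_conv_set.
Qed.

Lemma conv_le1 A B x : measurable A -> measurable B -> conv A B x <= 1.
Proof.
by move=> mA mB; apply: (le_trans (conv_le_r x mA mB)); exact: fprob_le1.
Qed.

Lemma measurable_torus_opp_set A : measurable A -> measurable [set x | A (- x)].
Proof.
by move=> mA; rewrite -[X in measurable X]setTI; exact: measurable_torusN.
Qed.

Lemma measurable_torus_sub_set A x : measurable A -> measurable [set y | A (x - y)].
Proof.
by move=> mA; have := measurable_conv_set x mA measurableT; rewrite setTI.
Qed.

(* Both sides are the convolution with the full group, integrated over each of
   its two variables. *)
Lemma torus_haar_opp A : measurable A -> mu [set x | A (- x)] = mu A.
Proof.
move=> mA; have := integral_conv mA measurableT.
rewrite [X in (_ = _ * X)%E -> _]probability_setT mule1 => <-.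
rewrite (eq_integral (fun=> (V [set x | A (- x)])%:E)); last first.
  move=> x _; congr EFin; rewrite /conv setTI; congr fine.
  rewrite -(torus_haar_translation x (measurable_torus_opp_set mA)).
  by congr (mu _); apply/seteqP; split => y; rewrite /translation/= opprB.
rewrite integral_cst// [X in (_ * X)%E]probability_setT mule1 fprobE//.
exact: measurable_torus_opp_set.
Qed.

Lemma fprob_translation A h : measurable A -> V (translation h A) = V A.
Proof. by move=> mA; rewrite /fprob torus_haar_translation. Qed.

Lemma fprob_opp A : measurable A -> V [set x | A (- x)] = V A.
Proof. by move=> mA; rewrite /fprob torus_haar_opp. Qed.

Lemma fprob_sub A x : measurable A -> V [set y | A (x - y)] = V A.
Proof.
move=> mA; rewrite /fprob -(torus_haar_opp mA).
rewrite -(torus_haar_translation x (measurable_torus_opp_set mA)).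
by congr (fine (mu _)); apply/seteqP; split => y; rewrite /translation/= opprB.
Qed.

Lemma conv_le_l A B x : measurable A -> measurable B -> conv A B x <= V A.
Proof.
move=> mA mB; rewrite -(fprob_sub x mA); apply: fprob_le => //.
- exact: measurable_conv_set.
- exact: measurable_torus_sub_set.
Qed.

Lemma conv_ge A B x : measurable A -> measurable B ->
  V A + V B - 1 <= conv A B x.
Proof.
move=> mA mB; have mAx := measurable_torus_sub_set x mA.
have := fprobUI mu mB mAx; rewrite fprob_sub//.
have := fprob_le1 mu (measurableU _ _ mB mAx).
by rewrite /conv; lra.
Qed.

Lemma conv_UI A A' B x : measurable A -> measurable A' -> measurable B ->
  conv (A `|` A') B x + conv (A `&` A') B x = conv A B x + conv A' B x.
Proof.
move=> mA mA' mB; rewrite /conv.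
rewrite -(fprobUI mu (measurable_conv_set x mA mB) (measurable_conv_set x mA' mB)).
by congr (V _ + V _); apply/seteqP; split => y/=; tauto.
Qed.

Lemma conv_le A A' B x : measurable A -> measurable A' -> measurable B ->
  A `<=` A' -> conv A B x <= conv A' B x.
Proof.
move=> mA mA' mB AA'; apply: fprob_le; try exact: measurable_conv_set.
by move=> y [By /AA'].
Qed.

Lemma conv_translation A B h x : conv (translation h A) B x = conv A B (x - h).
Proof.
rewrite /conv; congr (V _); apply/seteqP.
by split => y; rewrite /translation/= addrAC.
Qed.

Lemma Rintegral_conv A B : measurable A -> measurable B ->
  \int[mu]_x conv A B x = V A * V B.
Proof.
by move=> mA mB; rewrite /Rintegral integral_conv// fineM// fin_num_measure.
Qed.

Lemma ge0_Rintegral_translation (f : T -> R) h : measurable_fun setT f ->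
  (forall x, 0 <= f x) -> \int[mu]_x f (x - h) = \int[mu]_x f x.
Proof.
move=> mf f0; congr fine.
have mh := @measurable_torus_shift R d (- h).
rewrite -(@ge0_integral_pushforward _ _ _ _ _ _ mh mu setT (EFin \o f))//.
- apply: eq_measure_integral => A mA _.
  exact: torus_haar_shift.
- exact/measurable_EFinP.
- by move=> x _; rewrite lee_fin.
Qed.

End convolution.

(** * Pollard's inequality *)

(** The pair [w], [u] has the same sum as [x], [y] but is more spread out, so a concave function has
    the smaller sum on it. *)
Lemma min_submodular (R : realDomainType) (x y u w t : R) :
  u <= x -> u <= y -> w + u = x + y ->
  Num.min w t + Num.min u t <= Num.min x t + Num.min y t.
Proof.
move=> ux uy wuxy; rewrite !minEle.
by case: (leP w t) => ?; case: (leP u t) => ?; case: (leP x t) => ?;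
  case: (leP y t) => ?; lra.
Qed.

Section pollard.
Context {R : realType} {d : nat}.
Local Notation T := (torus R d).
Local Notation mu := (torus_haar R d).
Local Notation V := (fprob mu).
Implicit Types (A B : set T) (x h : T) (t : R).

(** A point of [A] outside the translate by [h + h'] is lost at the first shift or at the second,
    and the second loss is a translate of the loss under [h']. *)
Lemma translation_setD_subadditive A h h' : measurable A ->
  V (A `\` translation (h + h') A) <=
  V (A `\` translation h A) + V (A `\` translation h' A).
Proof.
move=> mA; have mt k := measurable_translation k mA.
have -> : V (A `\` translation h' A) =
    V (translation h A `\` translation (h + h') A).
  rewrite -(fprob_translation h (measurableD mA (mt h'))).
  congr (V _); apply/seteqP; split => x;
    by rewrite /translation/= opprD addrA.
have m1 := measurableD mA (mt h).
have m2 := measurableD (mt h) (mt (h + h')).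
apply: (le_trans _ (fprobU_le mu m1 m2)).
apply: fprob_le; [exact: measurableD|exact: measurableU|].
by move=> x [Ax nAx]; have [Ahx|nAhx] := pselect (translation h A x); [right|left].
Qed.

(** The overlap of [A] with its translate by [h] is the convolution of [- A] and [A] at [h], so its
    mean over [h] is [V A ^+ 2]. *)
Lemma exists_translation_setI_small A (s : R) : measurable A ->
  V A ^+ 2 < V A - s -> exists h, V (A `&` translation h A) <= V A - s.
Proof.
move=> mA As; apply: contrapT => /forallNP noh.
have mA' := measurable_torus_opp_set mA.
have convE h : conv [set x | A (- x)] A h = V (A `&` translation h A).
  by rewrite /conv; congr (V _); apply/seteqP; split => x;
    rewrite /translation/= opprB.
have : \int[mu]_x (V A - s) <= \int[mu]_x conv [set x | A (- x)] A x.
  apply: le_Rintegral => //.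
  - exact: (@bounded_integrable _ _ _ mu _ (`|V A - s|)).
  - apply: (@bounded_integrable _ _ _ mu _ 1); first exact: measurable_conv.
    by move=> x; rewrite ger0_norm ?conv_ge0 ?conv_le1.
  - by move=> x _; rewrite convE leNgt; apply/negP => /ltW; exact: noh.
by rewrite Rintegral_prob_cst Rintegral_conv// fprob_opp//; lra.
Qed.

(* Halving a translation at most halves the displaced measure and, repeated,
   makes it tend to 0; so some halving lands in the window [[s / 2, s]]. *)
Lemma exists_translation_setD A (s : R) : measurable A -> 0 < s ->
  V A ^+ 2 < V A - s ->
  exists h, s / 2 <= V (A `\` translation h A) <= s.
Proof.
move=> mA s0 As; have [v hv] := exists_translation_setI_small mA As.
pose D k := V (A `\` translation (dyadic_part v k) A).
have D0 : s <= D 0%N.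
  rewrite /D dyadic_part0 fprobD//; last exact: measurable_translation.
  by lra.
have DS k : D k <= 2 * D k.+1.
  have := translation_setD_subadditive (dyadic_part v k.+1) (dyadic_part v k.+1) mA.
  by rewrite dyadic_partS -/(D k) -/(D k.+1); lra.
have exD : exists k, D k <= s.
  have [_ /(_ _ s0)[N _ hN]] := translation_dyadic_cvg v mA.
  by exists N; apply/ltW; exact: (hN N (leqnn N)).
have [[|k] Dk kmin] := ex_minnP exD.
  by exists (dyadic_part v 0); rewrite -/(D 0%N) Dk andbT; lra.
exists (dyadic_part v k.+1); rewrite -/(D k.+1) Dk andbT.
have : ~~ (D k <= s) by apply/negP => /kmin; rewrite ltnn.
by rewrite -ltNge => sD; have := DS k; lra.
Qed.

Definition trunc_conv A B t : R := \int[mu]_x Num.min (conv A B x) t.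

Section fixed.
Variables (B : set T) (t : R).
Hypotheses (mB : measurable B) (t0 : 0 <= t).
Local Notation J A := (trunc_conv A B t).

Lemma measurable_min_conv A : measurable A ->
  measurable_fun setT (fun x => Num.min (conv A B x) t).
Proof. by move=> mA; apply: measurable_minr => //; exact: measurable_conv. Qed.

Lemma min_conv_ge0 A x : 0 <= Num.min (conv A B x) t.
Proof. by rewrite le_min conv_ge0. Qed.

Lemma integrable_min_conv A : measurable A ->
  mu.-integrable setT (EFin \o (fun x => Num.min (conv A B x) t)).
Proof.
move=> mA; apply: (@bounded_integrable _ _ _ mu _ t).
  exact: measurable_min_conv.
by move=> x; rewrite ger0_norm ?min_conv_ge0// ge_min lexx orbT.
Qed.

Lemma trunc_conv_ge0 A : 0 <= J A.
Proof. by apply: Rintegral_ge0 => x _; exact: min_conv_ge0. Qed.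

Lemma trunc_conv_translation A h : measurable A -> J (translation h A) = J A.
Proof.
move=> mA; rewrite /trunc_conv.
under eq_Rintegral do rewrite conv_translation.
apply: (ge0_Rintegral_translation (f := fun x => Num.min (conv A B x) t)).
  exact: measurable_min_conv.
exact: min_conv_ge0.
Qed.

(* Submodularity, from the concavity of [Num.min _ t]. *)
Lemma trunc_conv_UI A A' : measurable A -> measurable A' ->
  J (A `|` A') + J (A `&` A') <= J A + J A'.
Proof.
move=> mA mA'; have mU := measurableU _ _ mA mA'; have mI := measurableI _ _ mA mA'.
rewrite /trunc_conv -!RintegralD//; try exact: integrable_min_conv.
apply: le_Rintegral => //.
- have := integrableD measurableT (integrable_min_conv mU) (integrable_min_conv mI).
  exact.
- have := integrableD measurableT (integrable_min_conv mA) (integrable_min_conv mA').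
  exact.
- move=> x _; apply: min_submodular; last exact: conv_UI.
  + by apply: conv_le => //; exact: subIsetl.
  + by apply: conv_le => //; exact: subIsetr.
Qed.

(** Since both F and [t] are at most [V A], pointwise [V A * min(F, t)] is at least [t * F];
    integrate and divide by [V A]. The bound is sharp at the left endpoint [V A = t]. *)
Lemma trunc_conv_ge_scaled A : measurable A -> t <= V A ->
  t * V B <= J A.
Proof.
move=> mA tA; have [A0|A0] := eqVneq (V A) 0.
  have t00 : t = 0 by apply/eqP; rewrite eq_le t0 andbT -A0.
  by rewrite {1}t00 mul0r; exact: trunc_conv_ge0.
have {}A0 : 0 < V A by rewrite lt_def A0 fprob_ge0.
rewrite -(ler_pM2l A0) [leLHS](_ : _ = t * (V A * V B)); last by ring.
rewrite -(Rintegral_conv mA mB) /trunc_conv -!RintegralZl//; last 2 first.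
  exact: integrable_min_conv.
  apply: (@bounded_integrable _ _ _ mu _ 1); first exact: measurable_conv.
  by move=> x; rewrite ger0_norm ?conv_ge0 ?conv_le1.
apply: le_Rintegral => //.
- apply: (@bounded_integrable _ _ _ mu _ t).
    by apply: measurable_funM => //; exact: measurable_conv.
  move=> x; rewrite ger0_norm; last by rewrite mulr_ge0// conv_ge0.
  by rewrite ler_piMr// conv_le1.
- apply: (@bounded_integrable _ _ _ mu _ t).
    by apply: measurable_funM => //; exact: measurable_min_conv.
  move=> x; rewrite ger0_norm; last by rewrite mulr_ge0// ?min_conv_ge0// fprob_ge0.
  rewrite -[leRHS]mul1r ler_pM ?min_conv_ge0 ?fprob_ge0 ?fprob_le1//.
  by rewrite ge_min lexx orbT.
- move=> x _ /=; rewrite minEle; case: (leP (conv A B x) t) => _.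
    by rewrite ler_wpM2r// conv_ge0.
  by rewrite mulrC ler_wpM2r// conv_le_l.
Qed.

(** The convolution is everywhere at least [V A + V B - 1]. This settles the right endpoint and the
    range beyond it. *)
Lemma trunc_conv_ge_cst A (r : R) : measurable A -> r <= t ->
  r <= V A + V B - 1 -> r <= J A.
Proof.
move=> mA rt rAB; rewrite -[leLHS](Rintegral_prob_cst mu).
apply: le_Rintegral => //.
- exact: (@bounded_integrable _ _ _ mu _ (`|r|)).
- exact: integrable_min_conv.
- by move=> x _; rewrite le_min rt andbT (le_trans rAB)// conv_ge.
Qed.

End fixed.

(* On the interval [t <= |A| <= 1 - |B| + t] the infimum of
   [trunc_conv A B t - t |A|] over sets of given measure is a concave function
   of the measure, by submodularity applied to [A] and a translate, and it is
   at least [t (|B| - t)] at both endpoints. The term [e |A|^2] makes the concavity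
   strict: starting from a counterexample, the functional could be lowered
   forever. *)
Lemma trunc_conv_ge_middle B t A : measurable B -> 0 <= t -> t <= V B ->
  measurable A -> t <= V A -> V A <= 1 - V B + t ->
  t * (V A + V B - t) <= trunc_conv A B t.
Proof.
move=> mB t0 tB mA0 tA0 A0T; rewrite leNgt; apply/negP => lt0.
have VB1 := fprob_le1 mu mB.
(* [v] is the common value at both endpoints. It and the next names are introduced opaquely, so that
   [lra] and [nra] treat them as atoms. *)
have [v vE] : exists v, v = t * (V B - t) by exists (t * (V B - t)).
have [c cE] : exists c, forall A, c A = trunc_conv A B t - t * V A.
  by exists (fun A => trunc_conv A B t - t * V A).
(* Half the deficit: the term [e * V A ^+ 2] is at most [e], so every set of the descent keeps [c]
   below [v - e]. *)
have [e eE] : exists e, e = (v - c A) / 2 by exists ((v - c A) / 2).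
have e0 : 0 < e by rewrite eE cE vE; lra.
have [psi psiE] : exists psi, forall A, psi A = c A - e * V A ^+ 2.
  by exists (fun A => c A - e * V A ^+ 2).
(* Sets of the descent have measure [a] with [a >= e] and [1 - a >= e], so
   [a - a ^+ 2 >= e ^+ 2 > s], as [exists_translation_setD] requires. Also [s <= e], so a
   displacement up to [s] stays within the interval. *)
have [s sE] : exists s, s = e ^+ 2 / 2 by exists (e ^+ 2 / 2).
have s0 : 0 < s by rewrite sE divr_gt0// exprn_gt0.
have es : 0 < e * s ^+ 2 / 4 by rewrite divr_gt0// mulr_gt0// exprn_gt0.
have step A1 : measurable A1 -> t <= V A1 -> V A1 <= 1 - V B + t ->
    psi A1 <= v - 2 * e -> exists A2, [/\ measurable A2, t <= V A2,
      V A2 <= 1 - V B + t & psi A2 <= psi A1 - e * s ^+ 2 / 4].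
  move=> mA1 tA1 A1T psiA1.
  have J1 := trunc_conv_ge_scaled mB t0 mA1 tA1.
  have J2 : V A1 + V B - 1 <= trunc_conv A1 B t.
    by apply: trunc_conv_ge_cst => //; lra.
  have A1_0 := fprob_ge0 mu A1; have A1_1 := fprob_le1 mu mA1.
  have sqA1 : 0 <= V A1 ^+ 2 <= 1.
    by rewrite exprn_ge0// expr_le1.
  have eA1 : e * V A1 ^+ 2 <= e by case/andP: sqA1 => _ ?; rewrite ler_piMr// ltW.
  have cA1 : c A1 <= v - e by rewrite psiE in psiA1; lra.
  (* With a = [V A1], [J1] and [J2] say that [c A1] is at least v - t (a - t) and v - (1 - t) (1 -
     |B| + t - a). A deficit [e] therefore keeps a at distance [e] from both ends. *)
  have a1 : e <= V A1 - t by rewrite cE vE in cA1; nra.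
  have a2 : e <= 1 - V B + t - V A1 by rewrite cE vE in cA1; nra.
  have [|h /andP[Dlo Dhi]] := @exists_translation_setD A1 s mA1 s0.
    by rewrite sE; nra.
  have mh := measurable_translation h mA1.
  have hI := fprobD mu mA1 mh.
  have hU := fprobUI mu mA1 mh; rewrite fprob_translation// in hU.
  set D := V (A1 `\` _) in Dlo Dhi hI.
  have EI : V (A1 `&` translation h A1) = V A1 - D by lra.
  have EU : V (A1 `|` translation h A1) = V A1 + D by lra.
  have se : s <= e by rewrite sE; nra.
  have sub := trunc_conv_UI mB t0 mA1 mh.
  rewrite trunc_conv_translation// in sub.
  (* The squares of a - D and a + D sum to 2 a^2 + 2 D^2, so intersection or union lowers [psi] by
     at least e D^2. *)
  have D2 : s ^+ 2 / 4 <= D ^+ 2 by nra.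
  have eD2 : e * (s ^+ 2 / 4) <= e * D ^+ 2 by rewrite ler_pM2l.
  have psisum : psi (A1 `&` translation h A1) + psi (A1 `|` translation h A1)
      <= 2 * psi A1 - 2 * (e * D ^+ 2).
    by rewrite !psiE !cE EI EU; nra.
  have [le|lt] := leP (psi (A1 `&` translation h A1)) (psi A1 - e * s ^+ 2 / 4).
    exists (A1 `&` translation h A1); split => //; first exact: measurableI.
    - by rewrite EI; lra.
    - by rewrite EI; lra.
  exists (A1 `|` translation h A1); split => //; first exact: measurableU.
  - by rewrite EU; lra.
  - by rewrite EU; lra.
  - by lra.
have descent n : exists A2, [/\ measurable A2, t <= V A2,
    V A2 <= 1 - V B + t & psi A2 <= v - 2 * e - n%:R * (e * s ^+ 2 / 4)].
  elim: n => [|n [A1 [mA1 tA1 A1T psiA1]]].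
    exists A; split => //; rewrite mul0r subr0 psiE.
    have : 0 <= e * V A ^+ 2 by rewrite mulr_ge0 ?exprn_ge0 ?fprob_ge0// ltW.
    by lra.
  have nes : 0 <= n%:R * (e * s ^+ 2 / 4) by rewrite mulr_ge0// ltW.
  have [|A2 [mA2 tA2 A2T psiA2]] := step A1 mA1 tA1 A1T; first by lra.
  by exists A2; split => //; rewrite -natr1 mulrDl mul1r; lra.
have psi_ge A1 : measurable A1 -> - (1 + t + e) <= psi A1.
  move=> mA1; have A1_0 := fprob_ge0 mu A1; have A1_1 := fprob_le1 mu mA1.
  have := trunc_conv_ge0 B t0 A1; rewrite psiE cE.
  have : e * V A1 ^+ 2 <= e.
    by rewrite ler_piMr ?(ltW e0)// expr_le1.
  have : t * V A1 <= t by rewrite ler_piMr.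
  by lra.
have [n hn] : exists n, v - 2 * e + (1 + t + e) < n%:R * (e * s ^+ 2 / 4).
  exists (Num.truncn ((v - 2 * e + (1 + t + e)) / (e * s ^+ 2 / 4))).+1.
  by rewrite -ltr_pdivrMr// truncnS_gt.
have [A1 [mA1 _ _ psiA1]] := descent n.
by have := psi_ge A1 mA1; lra.
Qed.

Theorem pollard A B t : measurable A -> measurable B -> 0 <= t ->
  t <= V A -> t <= V B ->
  t * Num.min (V A + V B - t) 1 <= trunc_conv A B t.
Proof.
move=> mA mB t0 tA tB; rewrite minEle; case: (leP (V A + V B - t) 1) => ABt.
  by apply: trunc_conv_ge_middle => //; lra.
by rewrite mulr1; apply: trunc_conv_ge_cst => //; lra.
Qed.

End pollard.

(** * Integrals of concave polynomials *)

Section concave_polynomials.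
Context {R : realType}.
Local Notation lambda := (@lebesgue_measure R).
Implicit Types (p phi : {poly R}) (a b y M : R).

Lemma measurable_horner p (D : set R) : measurable_fun D (horner p).
Proof.
apply: measurable_funTS; apply: continuous_measurable_fun.
exact: continuous_horner.
Qed.

Lemma integral_horner_deriv p a b : a <= b ->
  (\int[lambda]_(t in `[a, b]) (p^`().[t])%:E = (p.[b] - p.[a])%:E)%E.
Proof.
rewrite le_eqVlt => /predU1P[->|ab].
  by rewrite set_itv1 integral_set1 subrr.
rewrite (@continuous_FTC2 _ _ (horner p))//.
- apply: continuous_subspaceT; exact: continuous_horner.
- split.
  + by move=> x _; exact: derivable_horner.
  + by apply: cvg_at_right_filter; exact: continuous_horner.
  + by apply: cvg_at_left_filter; exact: continuous_horner.
- by move=> x _; rewrite -derivE.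
Qed.

(** For integrands with one kink: that of [Num.min y t] at [y], and later that of Pollard's bound at
    |A| + |B| - 1. *)
Lemma integral_piecewise_horner_deriv (f : R -> R) p q a b c :
  a <= b -> b <= c -> measurable_fun `[a, c] f ->
  (forall t, a <= t <= c -> 0 <= f t) ->
  (forall t, a <= t <= b -> f t = p^`().[t]) ->
  (forall t, b <= t <= c -> f t = q^`().[t]) ->
  (\int[lambda]_(t in `[a, c]) (f t)%:E =
   (p.[b] - p.[a] + (q.[c] - q.[b]))%:E)%E.
Proof.
move=> ab bc mf f0 fp fq.
have U : `[a, c]%classic = `[a, b] `|` `]b, c].
  apply/seteqP; split => t/=; rewrite !in_itv/=.
    move=> /andP[at_ tc]; have [tb|bt] := leP t b; first by left; rewrite at_.
    by right; rewrite tc.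
  move=> [/andP[-> tb]|/andP[bt ->]]; first by rewrite (le_trans tb).
  by rewrite andbT (le_trans ab)// ltW.
rewrite EFinD -!integral_horner_deriv//.
rewrite -(@integral_itv_obnd_cbnd _ b (BRight c)); last first.
  by apply/measurable_EFinP; exact: measurable_horner.
have {}f0 t : (`[a, b] `|` `]b, c])%classic t -> 0 <= f t.
  by rewrite -U/= in_itv/= => /f0.
rewrite U in mf *; rewrite ge0_integral_setU//=; last 2 first.
- exact/measurable_EFinP.
- apply/disj_setPS => t/=; rewrite !in_itv/= => -[/andP[_ tb] /andP[bt _]].
  by move: (lt_le_trans bt tb); rewrite ltxx.
congr (_ + _)%E; apply: eq_integral => t; rewrite inE/= in_itv/=.
  by move=> /fp ->.
by move=> /andP[/ltW bt tc]; rewrite fq// bt.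
Qed.

(** Taylor's formula with integral remainder, by integration by parts on both sides of the kink
    [t = y]. *)
Lemma integral_deriv2_min phi M y : 0 <= y <= M -> phi.[0] = 0 ->
  (forall t, 0 <= t <= M -> phi^`()^`().[t] <= 0) ->
  (\int[lambda]_(t in `[0%R, M]) (- phi^`()^`().[t] * Num.min y t)%:E =
   (phi.[y] - phi^`().[M] * y)%:E)%E.
Proof.
move=> /andP[y0 yM] phi0 cphi.
rewrite (@integral_piecewise_horner_deriv _ (phi - 'X * phi^`())
  (- y *: phi^`()) _ y)//.
- by congr EFin; rewrite !(hornerD, hornerN, hornerM, hornerX, hornerZ) phi0; ring.
- apply: measurable_funM.
    by apply: measurable_funN; exact: measurable_horner.
  exact: measurable_minr.
- move=> t /[dup] /cphi ? /andP[t0 _]; rewrite mulr_ge0 ?oppr_ge0//.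
  by rewrite le_min y0.
- move=> t /andP[_ ty]; rewrite min_r// derivB derivM derivX
    !(hornerD, hornerN, hornerM, hornerX, hornerC); ring.
- move=> t /andP[yt _]; rewrite min_l// derivZ hornerZ; ring.
Qed.

Section integral_concave.
Context {dsp : measure_display} {T : measurableType dsp} (mu : probability T R).
Variables (F : T -> R) (phi : {poly R}) (M : R) (g : R -> R).
Hypotheses (mF : measurable_fun setT F) (FM : forall x, 0 <= F x <= M).
Hypotheses (phi0 : phi.[0] = 0) (dphiM : 0 <= phi^`().[M])
  (cphi : forall t, 0 <= t <= M -> phi^`()^`().[t] <= 0).
Hypotheses (mg : measurable_fun (`[0, M] : set R) g)
  (g0 : forall t, 0 <= t <= M -> 0 <= g t)
  (gF : forall t, 0 <= t <= M -> g t <= \int[mu]_x Num.min (F x) t).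

(* A concave [phi] vanishing at [0] is a mixture of the functions [id] and
   [Num.min _ t], with weights [phi'(M)] and [- phi''(t) dt]. *)
Lemma integral_concave_horner_ge :
  ((phi^`().[M] * \int[mu]_x F x)%:E +
    \int[lambda]_(t in `[0%R, M]) (- phi^`()^`().[t] * g t)%:E <=
   \int[mu]_x (phi.[F x])%:E)%E.
Proof.
(* The indicator extends the integrand to the whole line, so that Tonelli applies on a product
   space. *)
pose K (z : T * measurableTypeR R) : \bar R :=
  ((- phi^`()^`().[z.2] * Num.min (F z.1) z.2) * \1_(`[0, M]%classic) z.2)%:E.
have mK : measurable_fun setT K.
  have mind : measurable_fun setT (\1_(`[0, M]%classic) : measurableTypeR R -> R).
    exact: measurable_indic.
  have mhorner : measurable_fun setT
      (fun t : measurableTypeR R => - phi^`()^`().[t]).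
    by apply: measurable_funN; exact: measurable_horner.
  apply/measurable_EFinP; apply: measurable_funM.
    apply: measurable_funM; first exact: (measurableT_comp mhorner measurable_snd).
    apply: measurable_minr; last exact: measurable_snd.
    exact: (measurableT_comp mF measurable_fst).
  exact: (measurableT_comp mind measurable_snd).
have K0 z : (0 <= K z)%E.
  rewrite lee_fin indicE; have [|_] := boolP (z.2 \in _); last by rewrite mulr0.
  rewrite inE/= in_itv/= mulr1 => z2; rewrite mulr_ge0 ?oppr_ge0 ?cphi//.
  by rewrite le_min; have /andP[-> _] := FM z.1; case/andP: z2.
have Ft x : (\int[lambda]_t K (x, t) = (phi.[F x] - phi^`().[M] * F x)%:E)%E.
  rewrite -(integral_deriv2_min (FM x) phi0 cphi) [RHS]integral_mkcond.
  apply: eq_integral => t _; rewrite /K patchE/= indicE.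
  by case: ifPn => _; rewrite ?mulr1 ?mulr0.
have intF : mu.-integrable setT (EFin \o F).
  apply: (@bounded_integrable _ _ _ mu _ M) => // x.
  by have /andP[? ?] := FM x; rewrite ger0_norm.
have -> : (\int[mu]_x (phi.[F x])%:E =
    (phi^`().[M] * \int[mu]_x F x)%:E + \int[mu]_x \int[lambda]_t K (x, t))%E.
  rewrite EFinM fineK; last exact: integrable_fin_num.
  rewrite -ge0_integralZl//; last 2 first.
  - exact/measurable_EFinP.
  - by move=> x _; rewrite lee_fin; have /andP[] := FM x.
  rewrite -ge0_integralD//.
  - by apply: eq_integral => x _; rewrite Ft -EFinM -EFinD addrC subrK.
  - by move=> x _; rewrite -EFinM lee_fin mulr_ge0//; have /andP[] := FM x.
  - by apply: measurable_funeM; exact/measurable_EFinP.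
  - by move=> x _; exact: integral_ge0.
  - exact: (measurable_fun_fubini_tonelli_F K).
apply: leeD => //.
(* After the exchange, the inner integral at fixed [t] is that of [Num.min (F x) t] times a
   nonnegative weight, and [gF] bounds it. *)
rewrite (fubini_tonelli K)// [leLHS]integral_mkcond.
apply: ge0_le_integral => //.
- move=> t _; rewrite patchE; case: ifPn => //; rewrite inE/= in_itv/= => t0M.
  by rewrite lee_fin mulr_ge0 ?oppr_ge0 ?cphi ?g0.
- apply/(measurable_restrictT _ _).1 => //.
  apply/measurable_EFinP; apply: measurable_funM => //.
  by apply: measurable_funN; exact: measurable_horner.
- exact: (measurable_fun_fubini_tonelli_G K).
move=> t _; rewrite patchE; case: ifPn => [|_]; last exact: integral_ge0.
move=> tM; have := tM; rewrite inE/= in_itv/= => t0M.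
have mt : measurable_fun setT (fun x => Num.min (F x) t) by exact: measurable_minr.
have -> : (\int[mu]_x K (x, t) =
    (- phi^`()^`().[t] * \int[mu]_x Num.min (F x) t)%:E)%E.
  rewrite EFinM fineK; last first.
    apply: integrable_fin_num => //.
    apply: (@bounded_integrable _ _ _ mu _ t) => // x.
    have /andP[? ?] := FM x; case/andP: t0M => ? ?.
    by rewrite ger0_norm ?ge_min ?lexx ?orbT// le_min; apply/andP.
  rewrite -ge0_integralZl//.
  - by apply: eq_integral => x _; rewrite /K/= indicE tM mulr1.
  - exact/measurable_EFinP.
  - move=> x _; have /andP[? ?] := FM x; case/andP: t0M => ? ?.
    by rewrite lee_fin le_min; apply/andP.
  - by rewrite lee_fin oppr_ge0 cphi.
by rewrite lee_fin ler_wpM2l ?oppr_ge0 ?cphi ?gF.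
Qed.

End integral_concave.

End concave_polynomials.

(** * The concave polynomial of the covering problem *)

Section covering_polynomial.
Context {R : realType}.
Local Notation lambda := (@lebesgue_measure R).
Variables (beta : R) (m : nat).
Hypothesis beta0 : 0 < beta.
Local Notation n := m.+1.

Let w : {poly R} := 1 - beta^-1 *: 'X.

Definition covering_poly : {poly R} := 1 - w ^+ n.
Local Notation phi := covering_poly.

(** An antiderivative of [covering_poly]; its value at 0 is not 0, but the bounds below use only
    differences. *)
Definition covering_primitive : {poly R} :=
  'X + (beta / n.+1%:R) *: w ^+ n.+1.
Local Notation Phi := covering_primitive.

Let wE t : w.[t] = 1 - t / beta.
Proof. by rewrite /w hornerD hornerN hornerZ hornerX hornerC mulrC. Qed.

Let derivw : w^`() = - beta^-1%:P.
Proof. by rewrite /w derivB derivZ derivX derivC sub0r alg_polyC. Qed.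

Lemma covering_polyE t : phi.[t] = 1 - (1 - t / beta) ^+ n.
Proof. by rewrite /phi hornerD hornerN horner_exp wE hornerC. Qed.

Lemma covering_primitiveE t :
  Phi.[t] = t + beta / n.+1%:R * (1 - t / beta) ^+ n.+1.
Proof. by rewrite /Phi hornerD hornerZ horner_exp wE hornerX. Qed.

Lemma covering_poly0 : phi.[0] = 0.
Proof. by rewrite covering_polyE mul0r subr0 expr1n subrr. Qed.

Let derivphi : phi^`() = (n%:R / beta) *: w ^+ m.
Proof.
rewrite /phi derivB derivC sub0r deriv_exp derivw /= mulNr mulNrn opprK.
by rewrite mul_polyC scalerMnl -mulr_natl.
Qed.

Lemma deriv_covering_primitive : Phi^`() = phi.
Proof.
rewrite /Phi derivD derivX derivZ deriv_exp derivw /= /phi; congr (_ + _).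
rewrite mulNr mulNrn scalerN mul_polyC scalerMnl scalerA.
rewrite (_ : _ * _ = 1) ?scale1r// -[_ *+ _]mulr_natl.
by field; rewrite (gt_eqF beta0) -natrD pnatr_eq0.
Qed.

Lemma covering_poly_deriv_ge0 t : t <= beta -> 0 <= phi^`().[t].
Proof.
move=> tb; rewrite derivphi hornerZ horner_exp wE mulr_ge0//.
  by rewrite divr_ge0// ltW.
by rewrite exprn_ge0// subr_ge0 ler_pdivrMr// mul1r.
Qed.

Lemma covering_poly_deriv2_le0 t : t <= beta -> phi^`()^`().[t] <= 0.
Proof.
move=> tb; rewrite derivphi derivZ hornerZ mulr_ge0_le0//.
  by rewrite divr_ge0// ltW.
rewrite deriv_exp derivw hornerMn mulNr hornerN hornerM hornerC horner_exp wE.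
rewrite mulNrn oppr_le0 mulrn_wge0// mulr_ge0 ?invr_ge0 ?(ltW beta0)//.
by rewrite exprn_ge0// subr_ge0 ler_pdivrMr// mul1r.
Qed.

(* Antiderivatives of [- phi''(t) t] and of [- phi''(t) t (S - t)]. *)
Let prim1 : {poly R} := phi - 'X * phi^`().
Let prim2 (S : R) : {poly R} :=
  - phi^`() * ('X * (S%:P - 'X)) + phi * (S%:P - 'X *+ 2) + Phi *+ 2.

Let deriv_prim1 : prim1^`() = - phi^`()^`() * 'X.
Proof. by rewrite /prim1 derivB derivM derivX; ring. Qed.

Let deriv_prim2 S : (prim2 S)^`() = - phi^`()^`() * ('X * (S%:P - 'X)).
Proof.
rewrite /prim2; move: deriv_covering_primitive; move: phi Phi => p q qp.
by rewrite !(derivD, derivN, derivM, derivMn, derivX, derivC) qp; ring.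
Qed.

Section integral.
Context {dsp : measure_display} {T : measurableType dsp} (mu : probability T R).
Variables (F : T -> R) (alpha : R).
Hypotheses (alpha0 : 0 < alpha) (alpha1 : alpha <= 1) (beta1 : beta <= 1).
Hypotheses (mF : measurable_fun setT F)
  (FM : forall x, 0 <= F x <= Num.min alpha beta).
Hypothesis intF : \int[mu]_x F x = alpha * beta.
Hypothesis gF : forall t, 0 <= t <= Num.min alpha beta ->
  t * Num.min (alpha + beta - t) 1 <= \int[mu]_x Num.min (F x) t.
Local Notation M := (Num.min alpha beta).
Local Notation S := (alpha + beta).

Let M_le_beta t : 0 <= t <= M -> t <= beta.
Proof. by move=> /andP[_]; rewrite le_min => /andP[]. Qed.

Let M_le_alpha t : 0 <= t <= M -> t <= alpha.
Proof. by move=> /andP[_]; rewrite le_min => /andP[]. Qed.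

Let M0 : 0 <= M. Proof. by rewrite le_min !ltW. Qed.

(** [M] and [S - M] are [alpha] and [beta] in some order. Hence the boundary term of [prim2] at [M]
    cancels phi'(M) times the integral of [F], and no derivative survives in the bounds. *)
Let MSM : M * (S - M) = alpha * beta.
Proof. by rewrite minEle; case: (leP alpha beta) => _; ring. Qed.

Let g t := t * Num.min (S - t) 1.

Let mg : measurable_fun (`[0, M] : set R) g.
Proof.
apply: measurable_funM => //; apply: measurable_minr => //.
exact: measurable_funB.
Qed.

Let g0 t : 0 <= t <= M -> 0 <= g t.
Proof.
move=> tM; rewrite mulr_ge0//; first by case/andP: tM.
by rewrite le_min ler01 andbT subr_ge0 (le_trans (M_le_alpha tM))// lerDl ltW.
Qed.

Let mf : measurable_fun (`[0, M] : set R) (fun t => - phi^`()^`().[t] * g t).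
Proof.
apply: measurable_funM => //.
by apply: measurable_funN; exact: measurable_horner.
Qed.

Let f0 t : 0 <= t <= M -> 0 <= - phi^`()^`().[t] * g t.
Proof.
move=> tM; rewrite mulr_ge0 ?g0// oppr_ge0 covering_poly_deriv2_le0//.
exact: M_le_beta.
Qed.

Let bound_ge I :
  (\int[lambda]_(t in `[0%R, M]) (- phi^`()^`().[t] * g t)%:E = I%:E)%E ->
  ((phi^`().[M] * (alpha * beta) + I)%:E <= \int[mu]_x (phi.[F x])%:E)%E.
Proof.
move=> IE; rewrite EFinD -IE -intF; apply: integral_concave_horner_ge => //.
- exact: covering_poly0.
- by apply: covering_poly_deriv_ge0; apply: M_le_beta; rewrite M0 lexx.
- by move=> t /M_le_beta; exact: covering_poly_deriv2_le0.
Qed.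

Lemma integral_covering_poly_ge_small : S <= 1 ->
  ((phi.[M] * (S - 2 * M) + 2 * (Phi.[M] - Phi.[0]))%:E <=
   \int[mu]_x (phi.[F x])%:E)%E.
Proof.
move=> S1; have := @bound_ge ((prim2 S).[M] - (prim2 S).[0]).
rewrite -integral_horner_deriv//; move=> /(_ _)/le_trans.
rewrite (_ : phi.[M] * _ + _ = phi^`().[M] * (alpha * beta) +
    ((prim2 S).[M] - (prim2 S).[0])); last first.
  rewrite -MSM /prim2; move: covering_poly0; move: phi Phi => p q p0.
  by rewrite !(hornerD, hornerN, hornerM, hornerX, hornerC, hornerMn) p0; ring.
apply => //; apply: eq_integral => t; rewrite inE/= in_itv/= => /andP[t0 _].
rewrite deriv_prim2 /g min_l; last by lra.
by rewrite !(hornerD, hornerN, hornerM, hornerX, hornerC).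
Qed.

Lemma integral_covering_poly_ge_large : 1 <= S ->
  ((phi.[M] * (S - 2 * M) + phi.[S - 1] * (S - 1)
      + 2 * (Phi.[M] - Phi.[S - 1]))%:E <=
   \int[mu]_x (phi.[F x])%:E)%E.
Proof.
move=> S1.
(* Both measures are at most 1, so the kink [S - 1] of [g] lies in the domain. There [S - t = 1], so
   the derivative terms of [prim1] and [prim2] cancel. *)
have SM : S - 1 <= M by rewrite le_min !lerBlDr lerD2l beta1 addrC lerD2l alpha1.
have := @bound_ge (prim1.[S - 1] - prim1.[0] + ((prim2 S).[M] - (prim2 S).[S - 1])).
rewrite (@integral_piecewise_horner_deriv _ _ prim1 (prim2 S) _ (S - 1))//.
- move=> /(_ erefl)/(le_trans _); apply.
  rewrite lee_fin le_eqVlt; apply/orP; left; apply/eqP.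
  rewrite -MSM /prim1 /prim2; move: covering_poly0; move: phi Phi => p q p0.
  by rewrite !(hornerD, hornerN, hornerM, hornerX, hornerC, hornerMn) p0; ring.
- by lra.
- move=> t /andP[_ tS]; rewrite deriv_prim1 /g min_r; last by lra.
  by rewrite !(hornerD, hornerN, hornerM, hornerX) mulr1.
- move=> t /andP[tS _]; rewrite deriv_prim2 /g min_l; last by lra.
  by rewrite !(hornerD, hornerN, hornerM, hornerX, hornerC).
Qed.

End integral.
End covering_polynomial.

(** * Reduction to convolutions *)

Section completion.
Context {R : realType} {d : nat}.
Local Notation T := (torus R d).
Local Notation mu := (torus_haar R d).
Local Notation V := (fprob mu).
Implicit Types A B N : set T.

(** Monotonicity of the outer measure squeezes [vol A] between two Borel sets of equal measure. *)
Lemma vol_between A A0 N : measurable A0 -> measurable N -> mu N = 0%E ->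
  A0 `<=` A -> A `<=` A0 `|` N -> vol A = V A0.
Proof.
move=> mA0 mN N0 A0A AN; rewrite /vol /fprob; congr fine.
apply/eqP; rewrite eq_le -[X in (X <= _)%E && _]/(mu^*%mu A); apply/andP; split.
  apply: (le_trans (le_mu_ext mu AN)).
  rewrite measurable_mu_extE; last exact: measurableU.
  by rewrite measureU0.
by rewrite -(measurable_mu_extE mu mA0); exact: le_mu_ext.
Qed.

Lemma lebesgue_measurable_between A : lebesgue_measurable A ->
  exists A0 N, [/\ measurable A0, measurable N, mu N = 0%E,
    A0 `<=` A & A `<=` A0 `|` N].
Proof.
move=> [A0 mA0 [N0 [N [mN N_0 N0N]] <-]]; exists A0, N; split => //.
exact: setUS.
Qed.

Lemma translateE A h : translate A h = translation h A.
Proof.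
apply/seteqP; split => x.
  by move=> [a Aa <-]; rewrite /translation/= addrK.
by move=> Axh; exists (x - h) => //; rewrite subrK.
Qed.

(** Finitely many translates of a null set form a null set, so for every outcome [A] may be replaced
    by its Borel part [A0]; the result is a section of one jointly measurable set. *)
Lemma vol_bigcup_translate A A0 N (n : nat) (h : 'I_n -> T) :
  measurable A0 -> measurable N -> mu N = 0%E ->
  A0 `<=` A -> A `<=` A0 `|` N ->
  vol (\bigcup_(i : 'I_n) translate A (h i)) =
  V [set x | exists i, A0 (x - h i)].
Proof.
move=> mA0 mN N0 A0A AN.
have mU (C : set T) : measurable C ->
    measurable (\bigcup_(i : 'I_n) translation (h i) C).
  by move=> mC; apply: fin_bigcup_measurable => // i _; exact: measurable_translation.
have -> : [set x | exists i, A0 (x - h i)] = \bigcup_(i : 'I_n) translation (h i) A0.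
  by apply/seteqP; split => x [i]; exists i.
apply: (@vol_between _ _ (\bigcup_(i : 'I_n) translation (h i) N)).
- exact: mU.
- exact: mU.
- apply/negligibleP; first exact: mU.
  rewrite (_ : \bigcup_i _ =
      \big[setU/set0]_(i <- enum 'I_n) translation (h i) N); last first.
    rewrite -bigcup_seq; apply/seteqP; split => x [i _ xi]; exists i => //=.
    by rewrite mem_enum.
  elim/big_ind : _ => [|C D|i _]; [exact: negligible_set0|exact: negligibleU|].
  apply/negligibleP; first exact: measurable_translation.
  by rewrite -[RHS]N0; exact: torus_haar_translation.
- move=> x [i _ xi]; exists i => //; rewrite translateE.
  exact: A0A.
- move=> x [i _]; rewrite translateE => /AN[xA|xN]; [left|right]; by exists i.
Qed.

End completion.

(** * The expected measure of the union as an integral over the torus *)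

Section expectation_of_union.
Context {R : realType} {d m : nat} {disp : measure_display}
  {Omega : measurableType disp} {P : probability Omega R}.
Local Notation T := (torus R d).
Local Notation mu := (torus_haar R d).
Local Notation V := (fprob mu).
Variables (A0 B0 : set T) (b : 'I_m -> {RV P >-> T}).
Hypotheses (mA : measurable A0) (mB : measurable B0) (B_gt0 : 0 < V B0)
  (b_indep : mutually_independent b)
  (b_unif : forall i E, measurable E ->
     P (b i @^-1` E) = (V (E `&` B0) / V B0)%:E).

Lemma integral_union_translates :
  (\int[P]_w (V [set x | exists i, A0 (x - b i w)])%:E =
   \int[mu]_x (1 - (1 - conv A0 B0 x / V B0) ^+ m)%:E)%E.
Proof.
pose S : set (Omega * T) := \bigcup_(i : 'I_m) [set z | A0 (z.2 - b i z.1)].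
have mS : measurable S.
  apply: fin_bigcup_measurable => // i _.
  have mb : measurable_fun setT (fun z : Omega * T => (z.2, b i z.1)).
    apply: measurable_fun_pair; first exact: measurable_snd.
    exact: (measurableT_comp (@measurable_funPT _ _ _ _ (b i)) measurable_fst).
  have mc := measurableT_comp (@measurable_torusB R d) mb.
  by have := mc measurableT A0 mA; rewrite setTI.
have SE w : [set x | exists i, A0 (x - b i w)] = [set x | S (w, x)].
  by apply/seteqP; split => x [i]; exists i.
rewrite (eq_integral (fun w => mu [set x | S (w, x)])); last first.
  by move=> w _; rewrite SE fprobE//; exact: (measurable_section mS).
rewrite (integral_section_swap P mu mS).
apply: eq_integral => x _.
have mAx := measurable_torus_sub_set x mA.
have mEx : measurable (~` [set y | A0 (x - y)]) by exact: measurableC.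
(* [x] is missed exactly when every [b i] avoids [x - A0]; the intersection over the full index set
   is the form to which independence applies. *)
rewrite (_ : [set w | S (w, x)] =
  ~` \bigcap_(i in [set` [set: 'I_m]%SET])
       (b i @^-1` (~` [set y | A0 (x - y)]))); last first.
  apply/seteqP; split => w.
    by move=> [i _ Ai] /(_ i); rewrite /= finset.inE => /(_ isT); exact.
  move=> /= nA; apply: contrapT => nS; apply: nA => i _ Ai.
  by apply: nS; exists i.
rewrite probability_setC; last first.
  apply: fin_bigcap_measurable => // i _.
  by rewrite -[X in measurable X]setTI; exact: measurable_funPT.
rewrite b_indep//.
rewrite (eq_bigr (fun=> (1 - conv A0 B0 x / V B0)%:E)); last first.
  move=> i _; rewrite b_unif//; congr EFin.
  have := fprobD mu mB mAx; rewrite setDE setIC => ->.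
  by rewrite -/(conv A0 B0 x) mulrBl divff// gt_eqF.
rewrite prodEFin prodr_const cardsT card_ord.
by rewrite EFinB.
Qed.

End expectation_of_union.

(** * Closed forms of the two bounds *)

Section closed_forms.
Context {R : realType}.
Variables (alpha beta : R) (m : nat).
Hypothesis beta0 : 0 < beta.
Local Notation n := m.+1.
Local Notation phi := (covering_poly beta m).
Local Notation Phi := (covering_primitive beta m).
Local Notation M := (Num.min alpha beta).
Local Notation S := (alpha + beta).

Let n1 : n%:R + 1 != 0 :> R.
Proof. by rewrite natr1 pnatr_eq0. Qed.

Let Sn : n.+1%:R = n%:R + 1 :> R.
Proof. by rewrite natr1. Qed.

Let b_neq0 : beta != 0.
Proof. by rewrite gt_eqF. Qed.

(** If [beta <= alpha], then [M = beta] and the powers of [1 - M / beta] vanish. This is the origin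
    of the indicator. *)
Lemma covering_closed_form_min :
  phi.[M] * (S - 2 * M) + 2 * Phi.[M] =
  alpha + beta - (n%:R - 1) / (n%:R + 1) * beta * (1 - alpha / beta) ^+ n.+1
    * (alpha < beta)%R%:R.
Proof.
rewrite covering_polyE covering_primitiveE// minEle Sn.
case: ltgtP => ab /=.
- rewrite mulr1 (exprS _ n); move: (_ ^+ n) (n%:R) n1 => u k k1; field.
  by rewrite b_neq0 k1.
- by rewrite divff// subrr !expr0n/=; ring.
- by rewrite ab divff// subrr !expr0n/=; ring.
Qed.

Lemma covering_closed_form_small :
  phi.[M] * (S - 2 * M) + 2 * (Phi.[M] - Phi.[0]) =
  alpha + (n%:R - 1) / (n%:R + 1) * beta
    - (n%:R - 1) / (n%:R + 1) * beta * (1 - alpha / beta) ^+ n.+1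
      * (alpha < beta)%R%:R.
Proof.
rewrite [2 * (_ - _)]mulrBr addrA covering_closed_form_min covering_primitiveE//.
rewrite mul0r subr0 expr1n Sn; move: (_ ^+ n.+1) (n%:R) n1 => u k k1.
by field; rewrite k1.
Qed.

Lemma covering_closed_form_large :
  phi.[M] * (S - 2 * M) + phi.[S - 1] * (S - 1) + 2 * (Phi.[M] - Phi.[S - 1]) =
  1 - ((1 - alpha) / beta) ^+ n
        * (beta - (n%:R - 1) / (n%:R + 1) * (1 - alpha))
    - (n%:R - 1) / (n%:R + 1) * beta * (1 - alpha / beta) ^+ n.+1
      * (alpha < beta)%R%:R.
Proof.
rewrite [2 * (_ - _)]mulrBr addrACA covering_closed_form_min.
rewrite covering_polyE covering_primitiveE// Sn.
have -> : 1 - (S - 1) / beta = (1 - alpha) / beta by field.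
rewrite (exprS ((1 - alpha) / beta) n).
move: (((1 - alpha) / beta) ^+ n) (_ ^+ n.+1) (_ < _) (n%:R) n1 => u v ind k k1.
by field; rewrite b_neq0 k1.
Qed.

End closed_forms.

Theorem corollary1p4 (R : realType) (n d : nat)
    (n_ge1 : (1 <= n)%N) (d_ge1 : (1 <= d)%N)
    (A B : set (torus R d))
    (mA : lebesgue_measurable A) (mB : lebesgue_measurable B)
    (A_gt0 : 0 < vol A) (B_gt0 : 0 < vol B)
    (disp : measure_display) (Omega : measurableType disp)
    (P : probability Omega R) (b : 'I_n -> {RV P >-> torus R d})
    (b_indep : mutually_independent b)
    (b_unif : forall i : 'I_n, uniform_on (b i) B) :
  (vol A + vol B <= 1 ->
    ((vol A + (n%:R - 1) / (n%:R + 1) * vol B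
      - (n%:R - 1) / (n%:R + 1) * vol B
        * (1 - vol A / vol B) ^+ n.+1 * (vol A < vol B)%R%:R)%:E
     <= 'E_P[fun w => vol (\bigcup_(i : 'I_n) translate A (b i w))])%E)
  /\
  (1 < vol A + vol B ->
    ((1 - ((1 - vol A) / vol B) ^+ n
          * (vol B - (n%:R - 1) / (n%:R + 1) * (1 - vol A))
      - (n%:R - 1) / (n%:R + 1) * vol B
        * (1 - vol A / vol B) ^+ n.+1 * (vol A < vol B)%R%:R)%:E
     <= 'E_P[fun w => vol (\bigcup_(i : 'I_n) translate A (b i w))])%E).
Proof.
have [A0 [N [mA0 mN N0 A0A AN]]] := lebesgue_measurable_between mA.
have [B0 [N' [mB0 mN' N'0 B0B BN']]] := lebesgue_measurable_between mB.
set V := fprob (torus_haar R d).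
have volA : vol A = V A0 by exact: (vol_between mA0 mN N0).
have volB : vol B = V B0 by exact: (vol_between mB0 mN' N'0).
rewrite volA in A_gt0 *; rewrite volB in B_gt0 *.
(* Being uniform on [B] and on its Borel part [B0] is the same, since the traces of [E] on them
   differ by a null set. *)
have b_unif0 i E : measurable E ->
    P (b i @^-1` E) = (V (E `&` B0) / V B0)%:E.
  move=> mE; rewrite b_unif// volB; congr (_ / _)%:E.
  apply: (vol_between _ mN' N'0); first exact: measurableI.
    exact: setIS.
  by move=> x [Ex /BN'[xB|xN]]; [left|right].
have -> : ('E_P[fun w => vol (\bigcup_(i : 'I_n) translate A (b i w))] =
    \int[torus_haar R d]_x (1 - (1 - conv A0 B0 x / V B0) ^+ n)%:E)%E.
  rewrite unlock -(integral_union_translates mA0 mB0 B_gt0 b_indep b_unif0).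
  apply: eq_integral => w _; congr EFin.
  exact: (vol_bigcup_translate _ mA0 mN N0).
have A_le1 : V A0 <= 1 by exact: fprob_le1.
have B_le1 : V B0 <= 1 by exact: fprob_le1.
have FM x : 0 <= conv A0 B0 x <= Num.min (V A0) (V B0).
  by rewrite conv_ge0 le_min conv_le_l// conv_le_r.
have gF t : 0 <= t <= Num.min (V A0) (V B0) ->
    t * Num.min (V A0 + V B0 - t) 1 <=
    \int[torus_haar R d]_x Num.min (conv A0 B0 x) t.
  rewrite le_min => /andP[t0 /andP[tA tB]]; exact: pollard.
have mF := measurable_conv mA0 mB0.
have intF := Rintegral_conv mA0 mB0.
case: n n_ge1 => // m _ in b b_indep b_unif b_unif0 *.
have -> : (\int[torus_haar R d]_x (1 - (1 - conv A0 B0 x / V B0) ^+ m.+1)%:E =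
    \int[torus_haar R d]_x ((covering_poly (V B0) m).[conv A0 B0 x])%:E)%E.
  by apply: eq_integral => x _; rewrite covering_polyE.
split => AB.
  rewrite -covering_closed_form_small//.
  exact: integral_covering_poly_ge_small.
rewrite -covering_closed_form_large//.
by apply: integral_covering_poly_ge_large => //; exact: ltW.
Qed.
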